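(* Let (1) $p$ be a prime; (2) $H$ and $L$ be transitive subgroups of $S_p$, such that $L$ is simple; (3) $K$ be an $H$-invariant subgroup of the direct product $N_{S_p}(L)^p$ containing $L^p$; (4) $\phi\colon H\to N_{S_p}(L)^p/K$ be a crossed homomorphism; and (5) $G_{H,L,K,\phi}=\{(h,v)\in H\ltimes N_{S_p}(L)^p : \phi(h)=vK\}\le S_p\wr S_p$. Then $G_{H,L,K,\phi}$ is a transitive, imprimitive subgroup of $S_{p^2}$, such that a Sylow $p$-subgroup of $G_{H,L,K,\phi}$ is isomorphic to $\mathbb{Z}_p\wr\mathbb{Z}_p$. Conversely, if $G$ is a transitive, imprimitive permutation group of degree $p^2$, where $p$ is a prime, such that a Sylow $p$-subgroup of $G$ is isomorphic to $\mathbb{Z}_p\wr\mathbb{Z}_p$, then $G$ is equivalent to $G_{H,L,K,\phi}=\{(h,v)\in H\ltimes N_{S_p}(L)^p : \phi(h)=vK\}$ for some transitive subgroups $H$ and $L$ of $S_p$ such that $L$ is simple, some $H$-invariant subgroup $K$ of $N_{S_p}(L)^p$ containing $L^p$, and some crossed homomorphism $\phi\colon H\to N_{S_p}(L)^p/K$.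
   Context: Permutation groups are equivalent if they are permutation isomorphic (conjugate in $S_{p^2}$). $S_p$ acts on $\mathbb{Z}_p$. The wreath product $S_p\wr S_p=S_p\ltimes (S_p)^p$ acts on $\mathbb{Z}_p\times\mathbb{Z}_p$ by $(h,v)(i,j)=(h(i),v_i(j))$ for $h\in S_p$, $v=(v_i)_{i\in\mathbb{Z}_p}\in (S_p)^p$. The subgroup $H\le S_p$ acts on $(S_p)^p$ by permuting coordinates, $(h\cdot v)_{h(i)}=v_i$, so multiplication is $(h_1,v_1)(h_2,v_2)=(h_1h_2,(h_2^{-1}\cdot v_1)v_2)$. For transitive simple $L\le S_p$, the quotient $N_{S_p}(L)/L$ is cyclic, so any $H$-invariant subgroup $K$ of $N_{S_p}(L)^p$ containing $L^p$ is normal in $N_{S_p}(L)^p$ and $N_{S_p}(L)^p/K$ is an abelian group, on which $H$ acts. For a group $H$ and an $H$-module $A$ (an abelian group, written additively, on which $H$ acts by automorphisms), a function $\phi\colon H\to A$ is a crossed homomorphism if $\phi(h_1h_2)=h_2^{-1}\cdot\phi(h_1)+\phi(h_2)$ for all $h_1,h_2\in H$. *)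

(* Defs.v *)
From mathcomp Require Import all_boot all_fingroup all_solvable.

Set Implicit Arguments.
Unset Strict Implicit.
Unset Printing Implicit Defensive.

Import GroupScope.

(* Permutations are composed by the library from left to right: (s * t) x is
   t (s x).  Permutation groups here act on the left, so a product h1 h2 of
   maps is written h2 * h1 throughout, and a left action h . v of such maps is
   an action of the library, v acted on by h. *)

(* (S_p)^p; 'I_p stands for Z_p. *)
Notation base p := {dffun forall _ : 'I_p, {perm 'I_p}}.

Section Wreath.

Variable p : nat.
Implicit Types (h : 'S_p) (v w : base p).

Definition base_power (A : {set 'S_p}) : {set base p} := setXn (fun _ => A).

Canonical base_power_group (A : {group 'S_p}) := [group of base_power A].

(* h . v, that is (h . v)_(h i) = v_i. *)
Definition base_act v h : base p := [ffun i => v (h^-1 i)].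

Lemma base_actE v h i : base_act v h (h i) = v i.
Proof. by rewrite ffunE permK. Qed.

Lemma base_act_is_action : is_action [set: 'S_p] base_act.
Proof.
apply: is_total_action => [v | v h1 h2]; apply/ffunP=> i; rewrite !ffunE.
  by rewrite invg1 perm1.
by rewrite invMg permM.
Qed.

Canonical base_action := Action base_act_is_action.

Lemma base_act_is_groupAction : is_groupAction [set: base p] base_action.
Proof.
move=> h _; rewrite inE; apply/andP; split.
  by apply/subsetP=> v _; rewrite inE.
apply/morphicP=> v w _ _; rewrite !actpermE /=.
by apply/ffunP=> i; rewrite !ffunE.
Qed.

Canonical base_groupAction := GroupAction base_act_is_groupAction.

Lemma quotient_base_actE (H : {group 'S_p}) (K : {group base p}) v h :
  [acts H, on K | base_action] -> h \in H -> v \in 'N(K) ->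
  (base_action / K)%act (coset K v) h = coset K (base_act v h).
Proof.
move=> /subsetP actsHK Hh nKv; rewrite /= qactE //.
by rewrite (@qact_domE _ _ _ _ base_groupAction K) ?subsetT ?actsHK.
Qed.

Definition wreath_fun h v (x : 'I_p * 'I_p) := (h x.1, v x.1 x.2).

Lemma wreath_fun_inj h v : injective (wreath_fun h v).
Proof.
move=> [i j] [i' j'] [] /= /perm_inj <-.
by move/perm_inj=> <-.
Qed.

(* The pair (h, v) of S_p wr S_p, as a permutation of Z_p x Z_p; the action
   is faithful, and S_p wr S_p is identified with its image. *)
Definition wreath_perm h v : {perm 'I_p * 'I_p} := perm (@wreath_fun_inj h v).

Lemma wreath_perm_inj h v h' v' :
  wreath_perm h v = wreath_perm h' v' -> h = h' /\ v = v'.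
Proof.
move=> /permP eq_hv.
have eq2 i j : (h i, v i j) = (h' i, v' i j).
  by have:= eq_hv (i, j); rewrite !permE.
split; first by apply/permP=> i; case: (eq2 i i).
by apply/ffunP=> i; apply/permP=> j; case: (eq2 i j).
Qed.

(* (h1, v1) (h2, v2) = (h1 h2, (h2^-1 . v1) v2) *)
Lemma wreath_permM h1 v1 h2 v2 :
  wreath_perm h2 v2 * wreath_perm h1 v1
    = wreath_perm (h2 * h1) (v2 * base_act v1 h2^-1).
Proof.
apply/permP=> x; rewrite permM !permE /wreath_fun /= dffunM !permM.
by rewrite ffunE invgK.
Qed.

Definition wreath (A B : {set 'S_p}) : {set {perm 'I_p * 'I_p}} :=
  [set wreath_perm h v | h in A, v in base_power B].

Lemma group_set_wreath (A B : {group 'S_p}) : group_set (wreath A B).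
Proof.
apply/group_setP; split=> [|_ _ /imset2P[h v Ah Bv ->] /imset2P[g w Ag Bw ->]].
  apply/imset2P; exists (1 : 'S_p) (1 : base p); rewrite ?group1 //.
  by apply/permP=> -[i j]; rewrite perm1 permE /wreath_fun /= ffunE !perm1.
rewrite wreath_permM; apply/imset2P.
exists (h * g) (v * base_act w h^-1); rewrite ?groupM //.
by apply/setXnP=> i; rewrite ffunE; move/setXnP: Bw; apply.
Qed.

Canonical wreath_group (A B : {group 'S_p}) := Group (group_set_wreath A B).

(* Z_p in its regular action, generated by i |-> i + 1 mod p. *)
Definition translations : {group 'S_p} := <[perm (@ordS_inj p)]>%G.

Definition Zp_wr_Zp : {group {perm 'I_p * 'I_p}} :=
  [group of wreath translations translations].

Definition wreath_crossed (H L : {set 'S_p}) (K : {set base p})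
    (phi : 'S_p -> coset_of K) : {set {perm 'I_p * 'I_p}} :=
  [set wreath_perm h v | h in H, v in base_power 'N(L) & phi h == coset K v].

End Wreath.

(* phi (h1 h2) = h2^-1 . phi h1 + phi h2, the abelian group A being written
   multiplicatively. *)
Definition crossed_hom (aT rT : finGroupType) (D : {set aT})
    (to : action D rT) (H : {set aT}) (A : {set rT}) (phi : aT -> rT) : Prop :=
  {in H, forall h, phi h \in A}
  /\ {in H &, forall h1 h2, phi (h2 * h1) = phi h2 * to (phi h1) h2^-1}.

Definition perm_equiv (T U : finType) (A : {set {perm T}}) (B : {set {perm U}})
    : Prop :=
  exists2 f : T -> U, bijective f &
    forall t : {perm U},
      t \in B <-> exists2 s, s \in A & forall x, t (f x) = f (s x).

Definition imprimitive (T : finType) (A : {set {perm T}}) : bool :=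
  [exists Q, imprimitivity_system A [set: T] 'P Q].

(* Main.v *)
(* Since |G_{H,L,K,phi}| = |H| |K| and H and L are transitive of degree p, this
   order is divisible by p^(p+1), the p-part of (p^2)!; so a Sylow p-subgroup
   of G_{H,L,K,phi} is one of S_{p^2}, just as Z_p wr Z_p is.

   Conversely, G lies in S_p wr S_p with a transitive projection H and a kernel
   K whose order is divisible by p^p.  A Sylow p-subgroup of K is thus one of
   (S_p)^p, a product of cyclic groups of order p, so K meets each of the p
   coordinate factors in a group A_i of order divisible by p.  The subgroup L_i
   generated by the p-elements of A_i is transitive and simple.  Conjugation by
   an element (h, v) of G maps L_i to L_{h i} by conjugation by v_i; as H is
   transitive, all the L_i become the same L in suitable coordinates of the
   blocks, and then G normalises L^p <= K. *)
Require Import Defs.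
From mathcomp Require Import all_boot all_fingroup all_solvable.

Set Implicit Arguments.
Unset Strict Implicit.
Unset Printing Implicit Defensive.

Import GroupScope.

(** * Block systems of transitive groups *)

Lemma card_imprimitivity_block (T : finType) (G : {group {perm T}})
    (Q : {set {set T}}) (B : {set T}) :
    [transitive G, on [set: T] | 'P] -> imprimitivity_system G [set: T] 'P Q ->
  B \in Q -> (#|Q| * #|B|)%N = #|T|.
Proof.
move=> trG /and3P[partQ actQ _] QB; rewrite -cardsT; apply/esym.
have [/eqP covQ tiQ /negP ntQ] := and3P partQ.
apply: (card_uniform_partition _ partQ) => C QC.
have /set0Pn[x Bx] : B != set0 by apply: contraPneq QB => ->.
have /set0Pn[y Cy] : C != set0 by apply: contraPneq QC => ->.
(* An element taking a point of [B] to a point of [C] takes [B] to a block that meets [C], hence to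
   [C] itself; so all blocks have the same size. *)
have [g Gg def_y] := atransP2 trG (in_setT x) (in_setT y).
have QBg : ('P^*)%act B g \in Q by rewrite (actsP actQ).
have -> : C = ('P^*)%act B g.
  apply: contraTeq QBg => neqC; apply/negP=> QBg.
  have /pred0P/(_ y) := trivIsetP tiQ _ _ QC QBg neqC.
  by rewrite /= Cy /= def_y => /negP[]; apply: imset_f.
by rewrite card_setact.
Qed.

(** The number of blocks would divide the prime degree, while [imprimitivity_system] demands more
    than one block and fewer blocks than points. *)
Lemma prime_trans_primitive (T : finType) (G : {group {perm T}}) :
  prime #|T| -> [transitive G, on [set: T] | 'P] ->
  [primitive G, on [set: T] | 'P].
Proof.
move=> T_pr trG; rewrite /primitive trG; apply/existsPn=> Q.
apply/negP=> impQ; have [/and3P[_ _ ntQ] _ /andP[Q_gt1]] := and3P impQ.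
have [B QB] : exists B, B \in Q by apply/set0Pn; rewrite -card_gt0 ltnW.
have oT := card_imprimitivity_block trG impQ QB.
have: #|Q| %| #|T| by rewrite -oT dvdn_mulr.
case/primeP: T_pr => _ dvT /dvT/pred2P[] oQ; first by rewrite oQ in Q_gt1.
by rewrite oQ cardsT ltnn.
Qed.

(** * The exponent of p in p! and in (p^2)! *)

Lemma logn_fact_prime p : prime p -> logn p p`! = 1%N.
Proof.
move=> p_pr; rewrite logn_fact // big_ltn ?ltnS ?prime_gt0 //.
rewrite big_nat_cond big1 => [|k]; first by rewrite addn0 expn1 divnn prime_gt0.
rewrite andbT ltnS => /andP[k_gt1 _]; apply: divn_small.
by rewrite -{1}(expn1 p) ltn_exp2l // prime_gt1.
Qed.

Lemma logn_fact_prime_square p : prime p -> logn p (p ^ 2)`! = p.+1.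
Proof.
move=> p_pr; have p_gt1 := prime_gt1 p_pr; have p_gt0 := prime_gt0 p_pr.
have p2_gt1: 1 < p ^ 2 by rewrite -{1}(expn0 p) ltn_exp2l.
(* In Legendre's sum only the terms for p and p^2 survive; they contribute p and 1. *)
rewrite logn_fact // big_ltn ?ltnS ?(ltnW p2_gt1) // big_ltn ?ltnS //.
rewrite big_nat_cond big1 => [|k].
  by rewrite addn0 divnn expn_gt0 p_gt0 expn1 expnS expn1 mulnK // addn1.
by rewrite andbT => /andP[k_gt2 _]; rewrite divn_small ?ltn_exp2l.
Qed.

(** * Permutation groups of prime degree *)

Section PrimeDegree.

Variables (p : nat) (p_pr : prime p).
Implicit Types A L P X : {group 'S_p}.

Lemma logn_card_perm_prime A : logn p #|A| <= 1.
Proof.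
rewrite -(logn_fact_prime p_pr).
have := cardSg (subsetT A); rewrite alt.card_Sym card_ord.
by apply: dvdn_leq_log; rewrite fact_gt0.
Qed.

Lemma card_Sylow_prime A P : p %| #|A| -> p.-Sylow(A) P -> #|P| = p.
Proof.
move=> pA sylP; rewrite (card_Hall sylP) p_part.
suff -> : logn p #|A| = 1%N by rewrite expn1.
apply/eqP; rewrite eqn_leq logn_card_perm_prime.
by rewrite -pfactor_dvdn ?expn1.
Qed.

Lemma dvdn_card_trans A : [transitive A, on [set: 'I_p] | 'P] -> p %| #|A|.
Proof. by move/atrans_dvd; rewrite cardsT card_ord. Qed.

(** A Sylow p-subgroup of [A] has order p and moves some point; the length of that point's orbit
    divides p and is not 1, so the orbit is everything. *)
Lemma trans_dvdn_card A : p %| #|A| -> [transitive A, on [set: 'I_p] | 'P].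
Proof.
move=> pA; have [P sylP] := Sylow_exists p A.
have oP := card_Sylow_prime pA sylP.
have [x ntx] : exists x, #|orbit 'P P x| != 1%N.
  apply/existsP; apply: contraTT (prime_gt1 p_pr) => /existsPn fixP.
  rewrite -oP -leqNgt; suff -> : P :=: 1 by rewrite cards1.
  apply/trivgP/subsetP=> s Ps; rewrite inE; apply/eqP/permP=> x.
  have /eqP/card_orbit1 orb1 := negbNE (fixP x).
  by have := mem_orbit 'P x Ps; rewrite orb1 perm1 => /set1P.
have ox: #|orbit 'P P x| = p.
  by apply/(prime_nt_dvdP p_pr ntx); have := dvdn_orbit 'P P x; rewrite oP.
have trP: [transitive P, on [set: 'I_p] | 'P].
  apply/imsetP; exists x => //; apply/esym/eqP.
  by rewrite eqEcard subsetT cardsT card_ord ox /=.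
by rewrite (atrans_supgroup (pHall_sub sylP) trP);
  apply/actsP=> s _ y; rewrite !inE.
Qed.

(** By transitivity [c] agrees at one point with some [s] in [P]. Both commute with the transitive
    group [P], so they agree at every point. *)
Lemma cent_trans_abelian (T : finType) (P : {group {perm T}}) :
  abelian P -> [transitive P, on [set: T] | 'P] -> 'C(P) \subset P.
Proof.
move=> abP trP; apply/subsetP=> c /centP cP.
case: (pickP T) => [x _ | T0]; last first.
  suff -> : c = 1 by rewrite group1.
  by apply/permP=> x; have := T0 x.
have [s Ps cx] := atransP2 trP (in_setT x) (in_setT (c x)).
suff -> : c = s by [].
apply/permP=> y; have [r Pr ->] := atransP2 trP (in_setT x) (in_setT y).
have := congr1 r cx; rewrite /= /aperm -!permM => cr.
by rewrite -(cP r Pr) cr (centsP abP s Ps r Pr).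
Qed.

(** This makes N(L)/L abelian. For a Sylow p-subgroup [P] of [L], of order p, N(P)/C(P) embeds in
    the abelian group Aut(P), so N(P)' lies in C(P), hence in [P] and in [L]. By the Frattini
    argument N(L) is the product of [L] and a subgroup of N(P). *)
Lemma norm_trans_prime_der1 L :
  [transitive L, on [set: 'I_p] | 'P] -> 'N(L)^`(1) \subset L.
Proof.
move=> trL; have pL := dvdn_card_trans trL.
have [P sylP] := Sylow_exists p L.
have oP := card_Sylow_prime pL sylP.
have cycP: cyclic P by rewrite prime_cyclic ?oP.
have trP: [transitive P, on [set: 'I_p] | 'P].
  by apply: trans_dvdn_card; rewrite oP.
have sCP: 'C(P) \subset P := cent_trans_abelian (cyclic_abelian cycP) trP.
have derNP: 'N(P)^`(1) \subset L.
  apply: subset_trans (subset_trans sCP (pHall_sub sylP)).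
  apply: der1_min (cent_norm P) _.
  have := first_isog (conj_aut_morphism P).
  rewrite ker_conj_aut => /isog_abelian ->.
  apply: abelianS (Aut_cyclic_abelian cycP).
  by apply/subsetP=> _ /morphimP[x _ _ ->]; apply: Aut_aut.
apply: der1_min (subxx _) _.
rewrite -(Frattini_arg (normalG L) sylP) quotientMidl sub_der1_abelian //.
by apply: subset_trans (dergS _ (subsetIr _ _)) derNP.
Qed.

Lemma dvdn_card_gen_p_elts A :
  p %| #|A| -> p %| #|<<[set s in A | p.-elt s]>>|.
Proof.
move=> pA; have [P sylP] := Sylow_exists p A.
rewrite -{1}(card_Sylow_prime pA sylP) cardSg //.
apply/subsetP=> s Ps; apply: mem_gen; rewrite inE (subsetP (pHall_sub sylP)) //.
exact: mem_p_elt (pHall_pgroup sylP) Ps.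
Qed.

(* A nontrivial normal subgroup is transitive, since the degree is prime;
   hence it contains a Sylow p-subgroup, and by normality all p-elements. *)
Lemma simple_gen_p_elts A :
  p %| #|A| -> simple <<[set s in A | p.-elt s]>>.
Proof.
move=> pA; have pL := dvdn_card_gen_p_elts pA.
pose L := <<[set s in A | p.-elt s]>>%G; rewrite -[<<_>>]/(gval L) in pL *.
have trL := trans_dvdn_card pL.
apply/simpleP; split=> [|X nsXL].
  by apply: contraTneq pL => ->; rewrite cards1 dvdn1 neq_ltn prime_gt1 ?orbT.
have [-> | ntX] := eqVneq (X : {set _}) 1; [by left | right].
have primL: [primitive L, on [set: 'I_p] | 'P].
  by apply: prime_trans_primitive trL; rewrite card_ord.
have [|trX] := prim_trans_norm primL nsXL.
  rewrite subsetI => /andP[_ /subsetP cX].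
  case/negP: ntX; apply/eqP/trivgP/subsetP=> s Xs.
  rewrite inE; apply/eqP/permP=> x.
  by rewrite perm1 (astabP (cX s Xs) x _ : s x = x).
have [R sylR] := Sylow_exists p X.
have oR := card_Sylow_prime (dvdn_card_trans trX) sylR.
apply/eqP; rewrite eqEsubset normal_sub //= gen_subG; apply/subsetP=> s.
rewrite inE => /andP[As ps].
have Ls: s \in L by apply: mem_gen; rewrite inE As.
have sylRL: p.-Sylow(L) R.
  rewrite pHallE (subset_trans (pHall_sub sylR)) ?normal_sub //=.
  have [S sylS] := Sylow_exists p L.
  by rewrite oR -(card_Hall sylS) (card_Sylow_prime pL sylS).
have [|y Ly sRs] := Sylow_subJ sylRL (_ : <[s]> \subset L) ps.
  by rewrite cycle_subG.
have: s \in X :^ y.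
  by rewrite -cycle_subG (subset_trans sRs) ?conjSg ?(pHall_sub sylR).
by rewrite (normsP (normal_norm nsXL)).
Qed.

End PrimeDegree.

(** * Subgroups of S_p wr S_p: projection to S_p and kernel *)

Section WreathProduct.

Variable p : nat.
Implicit Types (h : 'S_p) (v w k : base p) (G : {group {perm 'I_p * 'I_p}}).

Lemma base_act1 v : base_act v 1 = v.
Proof. by apply/ffunP=> i; rewrite ffunE invg1 perm1. Qed.

Lemma mem_wreathT t :
  reflect (exists h v, t = wreath_perm h v)
    (t \in wreath [set: 'S_p] [set: 'S_p]).
Proof.
apply: (iffP imset2P) => [[h v _ _ ->] | [h [v ->]]]; first by exists h, v.
by exists h v => //; apply/setXnP=> i; rewrite inE.
Qed.

Lemma card_wreath (A B : {set 'S_p}) : #|wreath A B| = (#|A| * #|B| ^ p)%N.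
Proof.
rewrite /wreath curry_imset2X.
rewrite card_imset => [|[h v] [h' v'] /wreath_perm_inj[/= -> ->] //].
by rewrite cardsX cardsXn prod_nat_const card_ord.
Qed.

Lemma wreath_perm1 : wreath_perm 1 1 = 1 :> {perm 'I_p * 'I_p}.
Proof.
by apply/permP=> -[i j]; rewrite perm1 permE /wreath_fun /= ffunE !perm1.
Qed.

Lemma wreath_perm_mull k h v :
  wreath_perm 1 k * wreath_perm h v = wreath_perm h (k * v).
Proof. by rewrite wreath_permM mul1g invg1 base_act1. Qed.

(** Conjugation by (h, v) acts on the base by [v] in each coordinate, then permutes the coordinates
    by [h]. Both the invariance of the kernel under the projection and the comparison of different
    coordinates rest on this. *)
Lemma wreath_permJ k h v :
  wreath_perm 1 k ^ wreath_perm h v = wreath_perm 1 (base_act (k ^ v) h).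
Proof.
rewrite conjgE; apply: (mulgI (wreath_perm h v)).
rewrite mulKVg wreath_perm_mull wreath_permM mulg1; congr wreath_perm.
by rewrite conjgE; apply/ffunP=> i; rewrite !ffunE invgK permK mulKVg.
Qed.

(** For a subgroup of the wreath product, [top_set] is its image in the top factor and [base_set]
    the kernel of that projection; they serve as H and K in the converse. *)
Definition top_set (A : {set {perm 'I_p * 'I_p}}) : {set 'S_p} :=
  [set h | [exists v, wreath_perm h v \in A]].

Definition base_set (A : {set {perm 'I_p * 'I_p}}) : {set base p} :=
  [set v | wreath_perm 1 v \in A].

Lemma top_setP (A : {set {perm 'I_p * 'I_p}}) h :
  reflect (exists v, wreath_perm h v \in A) (h \in top_set A).
Proof. by rewrite inE; apply: existsP. Qed.

Lemma group_set_top_set G : group_set (top_set G).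
Proof.
apply/group_setP; split=> [|h1 h2 /top_setP[v1 Gv1] /top_setP[v2 Gv2]].
  by apply/top_setP; exists 1; rewrite wreath_perm1.
apply/top_setP; exists (v1 * base_act v2 h1^-1).
by rewrite -wreath_permM groupM.
Qed.

Canonical top_set_group G := Group (group_set_top_set G).

Lemma group_set_base_set G : group_set (base_set G).
Proof.
apply/group_setP; split=> [|v1 v2]; rewrite !inE ?wreath_perm1 // => Gv1 Gv2.
by rewrite -wreath_perm_mull groupM.
Qed.

Canonical base_set_group G := Group (group_set_base_set G).

(** The elements of [G] over a fixed [h] form a single coset of the kernel; this gives the order of
    [G] and makes the crossed homomorphism well defined. *)
Lemma mem_wreath_permMl G k h v :
  wreath_perm h v \in G -> (wreath_perm h (k * v) \in G) = (k \in base_set G).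
Proof. by move=> Ghv; rewrite -wreath_perm_mull groupMr // inE. Qed.

Lemma card_top_base G :
  G \subset wreath [set: 'S_p] [set: 'S_p] ->
  #|G| = (#|top_set G| * #|base_set G|)%N.
Proof.
move=> sGW; pose D := [set x : 'S_p * base p | wreath_perm x.1 x.2 \in G].
have defG : G :=: [set wreath_perm x.1 x.2 | x in D].
  apply/setP=> t; apply/idP/imsetP=> [Gt | [x /[!inE] Gx -> //]].
  have /mem_wreathT[h [v def_t]] := subsetP sGW t Gt.
  by exists (h, v); rewrite // inE /= -def_t.
rewrite [in LHS]defG.
rewrite card_imset => [|[h v] [h' v'] /wreath_perm_inj[/= -> ->] //].
rewrite -sum1_card.
rewrite (eq_bigl (fun x => xpredT x.1 && (wreath_perm x.1 x.2 \in G))).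
  rewrite -(pair_big_dep xpredT (fun h v => wreath_perm h v \in G)
             (fun _ _ => 1%N)).
  rewrite -sum_nat_const [RHS]big_mkcond; apply: eq_bigr => h _ /=.
  (* The fibre over [h] is a coset of [base_set G] when [h] lies in the projection, and is empty
     otherwise. *)
  rewrite sum1_card; case: top_setP => [[v Gv] | notGh].
    have /= <- := card_rcoset (base_set_group G) v; apply: eq_card => w.
    by rewrite mem_rcoset -(mem_wreath_permMl (w * v^-1) Gv) mulgKV.
  by apply: eq_card0 => v; apply/negP=> Gv; apply: notGh; exists v.
by move=> x; rewrite inE.
Qed.

End WreathProduct.

(** * Sylow p-subgroups in degree p^2 *)

Lemma card_translations p : prime p -> #|translations p| = p.
Proof.
move=> p_pr; have p_gt0 := prime_gt0 p_pr.
apply: nt_prime_order => //.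
  apply/permP=> i; rewrite permX perm1; apply: val_inj.
  have -> k : val (iter k (perm (@ordS_inj p)) i) = (i + k) %% p.
    elim: k => [|k IHk]; first by rewrite addn0 modn_small.
    by rewrite iterS permE /= IHk -(addn1 (_ %% _)) modnDml addn1 addnS.
  by rewrite modnDr modn_small.
apply/eqP=> /permP/(_ (Ordinal p_gt0)); rewrite permE perm1 => /(congr1 val) /=.
by rewrite modn_small // prime_gt1.
Qed.

Lemma card_Zp_wr_Zp p : prime p -> #|Zp_wr_Zp p| = (p ^ p.+1)%N.
Proof. by move=> p_pr; rewrite /= card_wreath card_translations // expnS. Qed.

(** Since p^(p+1) is the full p-part of (p^2)!, a Sylow p-subgroup of [G] already has the order of
    one of the symmetric group. *)
Lemma part_card_perm_square p (T : finType) (P G : {group {perm T}}) :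
  prime p -> #|T| = (p ^ 2)%N -> p.-Sylow(G) P ->
  (p ^ p.+1)%N %| #|G| -> p.-Sylow([set: {perm T}]) P.
Proof.
move=> p_pr oT sylP pG; rewrite pHallE subsetT /= alt.card_Sym oT.
rewrite eqn_dvd (card_Hall sylP) !p_part logn_fact_prime_square //.
rewrite !dvdn_Pexp2l ?prime_gt1 // -pfactor_dvdn // pG andbT.
rewrite -(logn_fact_prime_square p_pr) -oT -alt.card_Sym.
by rewrite dvdn_leq_log ?cardSg ?subsetT.
Qed.

(** [P] and [Zp_wr_Zp p] are both Sylow subgroups of the same symmetric group, hence conjugate. *)
Lemma Sylow_isog_Zp_wr_Zp p (P G : {group {perm 'I_p * 'I_p}}) :
  prime p -> p.-Sylow(G) P -> (p ^ p.+1)%N %| #|G| -> P \isog Zp_wr_Zp p.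
Proof.
move=> p_pr sylP pG.
have oT: #|{: 'I_p * 'I_p}| = (p ^ 2)%N.
  by rewrite card_prod card_ord expnS expn1.
have sylPT := part_card_perm_square p_pr oT sylP pG.
have sylZ: p.-Sylow([set: {perm 'I_p * 'I_p}]) (Zp_wr_Zp p).
  (* [Zp_wr_Zp p] is a p-group, so it is its own Sylow p-subgroup. *)
  have [Q sylQ] := Sylow_exists p (Zp_wr_Zp p).
  suff <- : Q :=: Zp_wr_Zp p.
    by apply: (part_card_perm_square p_pr oT sylQ); rewrite card_Zp_wr_Zp.
  apply/eqP; rewrite eqEcard (pHall_sub sylQ) (card_Hall sylQ).
  by rewrite card_Zp_wr_Zp // part_pnat_id ?leqnn // pnatX pnat_id.
have [x _ ->] := Sylow_trans sylPT sylZ.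
exact: conj_isog.
Qed.

(** * The groups G_{H,L,K,phi}: the direct implication *)

Section WreathCrossed.

Variables (p : nat) (p_pr : prime p).
Implicit Types (h : 'S_p) (v w : base p).

Lemma base_powerP (A : {set 'S_p}) v :
  reflect (forall i, v i \in A) (v \in base_power A).
Proof. by apply: (iffP idP) => /setXnP. Qed.

(** N(L)' lies in [L], so coordinatewise the derived group of N(L)^p lies in L^p, hence in [K]. The
    result matters because [coset K v] is a genuine coset only for [v] in ['N(K)]. *)
Lemma base_power_norm (L : {group 'S_p}) (K : {group base p}) :
  [transitive L, on [set: 'I_p] | 'P] ->
  base_power L \subset K -> K \subset base_power 'N(L) ->
  base_power 'N(L) \subset 'N(K).
Proof.
move=> trL sLK sKN; apply: sub_der1_norm sKN.
apply: subset_trans sLK; rewrite gen_subG.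
apply/subsetP=> _ /imset2P[v w /base_powerP Nv /base_powerP Nw ->].
apply/base_powerP=> i; apply: subsetP (norm_trans_prime_der1 p_pr trL) _ _.
have -> : [~ v, w] i = [~ v i, w i] by rewrite /commg /conjg !ffunE.
by apply: mem_commg; [exact: Nv | exact: Nw].
Qed.

Variables (H L : {group 'S_p}) (K : {group base p}) (phi : 'S_p -> coset_of K).
Hypotheses (trH : [transitive H, on [set: 'I_p] | 'P])
  (trL : [transitive L, on [set: 'I_p] | 'P])
  (sLK : base_power L \subset K) (sKN : K \subset base_power 'N(L))
  (actHK : [acts H, on K | base_action p])
  (phiP : crossed_hom (base_action p / K) H (base_power 'N(L) / K) phi).

Let nKN : base_power 'N(L) \subset 'N(K) := base_power_norm trL sLK sKN.

Lemma mem_wreath_crossed h v :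
  (wreath_perm h v \in wreath_crossed H L phi) =
    [&& h \in H, v \in base_power 'N(L) & phi h == coset K v].
Proof.
apply/imset2P/and3P=> [[h' v' Hh'] | [Hh Nv phi_h]].
  by rewrite inE => /andP[Nv' phi_h'] /wreath_perm_inj[-> ->].
by exists h v; rewrite // inE Nv.
Qed.

Lemma wreath_crossed_sub :
  wreath_crossed H L phi \subset wreath [set: 'S_p] [set: 'S_p].
Proof.
by apply/subsetP=> _ /imset2P[h v _ _ ->]; apply/mem_wreathT; exists h, v.
Qed.

Lemma crossed_hom_rep h : h \in H ->
  exists2 v, v \in base_power 'N(L) & phi h = coset K v.
Proof.
by case: phiP => phiN _ /phiN /morphimP[v _ Nv ->]; exists v.
Qed.

Lemma group_set_wreath_crossed : group_set (wreath_crossed H L phi).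
Proof.
have actN : {in base_power 'N(L), forall v h,
    base_act v h \in base_power 'N(L)}.
  by move=> v /base_powerP Nv h; apply/base_powerP=> i; rewrite ffunE.
case: phiP => phiN phiM; apply/group_setP; split=> [|t1 t2].
  rewrite -(@wreath_perm1 p) mem_wreath_crossed !group1 /= morph1.
  have [v Nv phi_1] := crossed_hom_rep (group1 H).
  (* The crossed identity at (1, 1) reads phi 1 = phi 1 * phi 1, so phi 1 is trivial. *)
  have := phiM 1 1 (group1 H) (group1 H).
  rewrite mulg1 invg1 act1 phi_1 => eq_v.
  by apply/eqP/(mulgI (coset K v)); rewrite mulg1 -eq_v.
case/imset2P=> h2 v2 Hh2 /setIdP[Nv2 /eqP phi2] ->.
case/imset2P=> h1 v1 Hh1 /setIdP[Nv1 /eqP phi1] ->.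
rewrite wreath_permM mem_wreath_crossed !groupM ?actN //=.
(* Closure under products is exactly the crossed identity, matched with the product rule of the
   wreath product. *)
rewrite phiM // phi1 phi2 (quotient_base_actE actHK) ?groupV ?(subsetP nKN) //.
by rewrite morphM ?(subsetP nKN) ?actN.
Qed.

Canonical wreath_crossed_group := Group group_set_wreath_crossed.

Lemma top_wreath_crossed : top_set (wreath_crossed H L phi) = H.
Proof.
apply/setP=> h; apply/top_setP/idP=> [[v] | Hh].
  by rewrite mem_wreath_crossed => /andP[].
have [v Nv phi_h] := crossed_hom_rep Hh.
by exists v; rewrite mem_wreath_crossed Hh Nv phi_h /=.
Qed.

Lemma base_wreath_crossed : base_set (wreath_crossed H L phi) = K.
Proof.
have phi1: phi 1 = 1.
  have: 1 \in wreath_crossed_group by apply: group1.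
  by rewrite -(@wreath_perm1 p) mem_wreath_crossed morph1 => /and3P[_ _ /eqP].
apply/setP=> k; rewrite inE mem_wreath_crossed group1 phi1 /= eq_sym.
apply/andP/idP=> [[Nk /eqP] | Kk]; last by rewrite coset_id // (subsetP sKN).
by apply: coset_idr; rewrite (subsetP nKN).
Qed.

Lemma card_wreath_crossed : #|wreath_crossed H L phi| = (#|H| * #|K|)%N.
Proof.
by rewrite (@card_top_base _ wreath_crossed_group wreath_crossed_sub)
           top_wreath_crossed base_wreath_crossed.
Qed.

(** The order is |H| |K|: transitivity of [H] gives one factor p, and that of [L] gives p^p through
    L^p inside [K]. *)
Lemma dvdn_card_wreath_crossed : (p ^ p.+1)%N %| #|wreath_crossed H L phi|.
Proof.
rewrite card_wreath_crossed expnS dvdn_mul ?dvdn_card_trans //.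
apply: dvdn_trans (cardSg sLK); rewrite cardsXn prod_nat_const card_ord.
by rewrite dvdn_exp2r ?dvdn_card_trans.
Qed.

Lemma wreath_crossed_trans :
  [transitive wreath_crossed H L phi, on [set: 'I_p * 'I_p] | 'P].
Proof.
have i0 := Ordinal (prime_gt0 p_pr).
apply/imsetP; exists (i0, i0) => //; apply/esym/setP=> -[i j]; rewrite inE.
have [h Hh /= def_i] := atransP2 trH (in_setT i0) (in_setT i).
have [v Nv phi_h] := crossed_hom_rep Hh.
(* An element over [h] reaches the right block; a constant tuple from L^p then corrects the second
   coordinate without changing the coset modulo [K]. *)
have [s Ls /= def_j] := atransP2 trL (in_setT (v i0 i0)) (in_setT j).
have Ks: [ffun _ => s] \in K.
  by apply: (subsetP sLK); apply/base_powerP=> k; rewrite ffunE.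
apply/imsetP; exists (wreath_perm h (v * [ffun _ => s])).
  have NKs := subsetP sKN _ Ks.
  by rewrite mem_wreath_crossed Hh groupM //= phi_h coset_kerr.
by rewrite /= /aperm permE /wreath_fun /= !ffunE permM def_i def_j.
Qed.

(** The blocks are the fibres of the first coordinate: (h, v) permutes them as [h] permutes indices,
    and 1 < p < p^2. *)
Lemma wreath_crossed_imprimitive : imprimitive (wreath_crossed H L phi).
Proof.
have p_gt1 := prime_gt1 p_pr; have j0 := Ordinal (prime_gt0 p_pr).
pose B (i : 'I_p) := [set x : 'I_p * 'I_p | x.1 == i].
have B_inj : injective B.
  by move=> i i' /setP/(_ (i, j0)); rewrite !inE eqxx => /esym/eqP.
apply/existsP; exists [set B i | i : 'I_p]; apply/and3P; split.
- apply/and3P; split.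
  + apply/eqP/setP=> x; rewrite inE; apply/bigcupP.
    by exists (B x.1); rewrite ?imset_f // inE.
  + apply/trivIsetP=> _ _ /imsetP[i _ ->] /imsetP[i' _ ->] neqB.
    apply/pred0P=> x; rewrite /= !inE; apply: contraNF neqB.
    by case/andP=> /eqP<- /eqP<-.
  by apply/imsetP=> -[i _ /setP/(_ (i, j0))]; rewrite !inE eqxx.
- apply/subsetP=> _ /imset2P[h v _ _ ->]; rewrite !inE /=.
  apply/subsetP=> _ /imsetP[i _ ->]; rewrite inE.
  apply/imsetP; exists (h i) => //.
  apply/setP=> y; rewrite inE; apply/imsetP/eqP=> [[x] | def_y].
    by rewrite inE => /eqP <- ->; rewrite /= /aperm permE.
  exists ((wreath_perm h v)^-1 y); last by rewrite /= /aperm permKV.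
  rewrite inE -(inj_eq (@perm_inj _ h)) -def_y.
  by rewrite -{2}(permKV (wreath_perm h v) y) [wreath_perm h v _]permE.
by rewrite card_imset // cardsT card_prod card_ord p_gt1 ltn_Pmull // ltnW.
Qed.

End WreathCrossed.

(** * The coordinate groups A_i and L_i, and the recovery of L and phi from G *)

Section Coordinates.

Variables (p : nat) (p_pr : prime p).
Implicit Types (h s : 'S_p) (v w k : base p) (G : {group {perm 'I_p * 'I_p}}).

Definition coord_embed i : 'S_p -> base p := @dfung1 'I_p (fun=> 'S_p) i.

Canonical coord_embed_morphism i := [morphism of coord_embed i].

(** This is A_i, and [coord_core] is L_i. They are pulled back to S_p, so that different coordinates
    can be compared. *)
Definition coord_group G i : {group 'S_p} := (coord_embed i @*^-1 base_set G)%G.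

Definition coord_core G i : {group 'S_p} :=
  <<[set s in coord_group G i | p.-elt s]>>%G.

Lemma mem_coord_group G i s :
  (s \in coord_group G i) = (wreath_perm 1 (coord_embed i s) \in G).
Proof. by rewrite !inE. Qed.

Lemma coord_embedJ i s v : coord_embed i s ^ v = coord_embed i (s ^ v i).
Proof.
apply/ffunP=> j; have [<- | neq_ij] := eqVneq i j.
  by rewrite conjgE !ffunE !dfwith_in conjgE.
by rewrite conjgE !ffunE !dfwith_out // mul1g mulVg.
Qed.

Lemma base_act_coord_embed i s h :
  base_act (coord_embed i s) h = coord_embed (h i) s.
Proof.
apply/ffunP=> j; rewrite ffunE -{2}(permKV h j).
have [<- | neq_ij] := eqVneq i (h^-1 j); first by rewrite !ffunE !dfwith_in.
by rewrite !ffunE !dfwith_out // (inj_eq perm_inj).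
Qed.

Lemma mem_coord_groupJ G i h v s :
  (s ^ v i \in coord_group (G :^ wreath_perm h v) (h i))
    = (s \in coord_group G i).
Proof.
rewrite !mem_coord_group -base_act_coord_embed.
by rewrite -coord_embedJ -wreath_permJ memJ_conjg.
Qed.

(** Here (h, v) is arbitrary: taken in [G] it relates L_i to L_{h i}, and with h = 1 it describes a
    change of coordinates inside the blocks. *)
Lemma coord_coreJ G i h v :
  coord_core (G :^ wreath_perm h v) (h i) = (coord_core G i :^ v i)%G.
Proof.
apply: group_inj; transitivity <<[set s in coord_group G i | p.-elt s] :^ v i>>.
  congr <<_>>; apply/setP=> s; rewrite -[s](conjgKV (v i)) memJ_conjg.
  apply/setIdP/setIdP=> -[]; rewrite !p_eltJ => Gs ps; split=> //.
    by rewrite -(mem_coord_groupJ G i h v).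
  by rewrite (mem_coord_groupJ G i h v).
exact: genJ.
Qed.

Lemma coord_core_norm G h v i :
  wreath_perm h v \in G -> coord_core G (h i) = (coord_core G i :^ v i)%G.
Proof.
move=> Ghv; rewrite -(coord_coreJ G i h v); congr coord_core.
by apply/group_inj; rewrite /= conjGid.
Qed.

(** L^p is the product of its coordinate factors, and each lies in the kernel because L_i is
    contained in A_i. *)
Lemma base_power_coord_core G (L : {group 'S_p}) :
  (forall i, coord_core G i = L) -> base_power L \subset base_set G.
Proof.
move=> defL; rewrite /base_power -setXn_prod prod_subG // => i _.
apply/subsetP=> _ /set1gXnP[s Ls ->].
suff: s \in coord_group G i by rewrite mem_coord_group inE.
suff: L \subset coord_group G i by move/subsetP; apply.
by rewrite -(defL i) gen_subG; apply/subsetP=> t /setIdP[].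
Qed.

Lemma dvdn_card_coord_group G i :
    G \subset wreath [set: 'S_p] [set: 'S_p] -> (p ^ p.+1)%N %| #|G| ->
  p %| #|coord_group G i|.
Proof.
move=> sGW pG; have p_gt0 := prime_gt0 p_pr; have p_gt1 := prime_gt1 p_pr.
have oB: logn p #|[set: base p]| = p.
  have -> : [set: base p] = base_power [set: 'S_p].
    by apply/setP=> v; rewrite inE; apply/esym/base_powerP=> j; rewrite inE.
  rewrite cardsXn prod_nat_const card_ord alt.card_Sym card_ord lognX.
  by rewrite logn_fact_prime // muln1.
have [R sylR] := Sylow_exists p (base_set_group G).
(* The projection accounts for at most one factor p of the order of [G], which leaves p^p for the
   kernel. *)
have oR: p <= logn p #|base_set G|.
  move: pG; rewrite card_top_base // pfactor_dvdn ?muln_gt0 ?cardG_gt0 //.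
  rewrite lognM ?cardG_gt0 // => le_p; rewrite -ltnS (leq_trans le_p) //.
  by rewrite -add1n leq_add2r (logn_card_perm_prime p_pr (top_set_group G)).
have sylRT: p.-Sylow([set: base p]) R.
  rewrite pHallE subsetT (card_Hall sylR) /= !p_part oB eqn_exp2l //.
  rewrite eqn_leq oR andbT -[X in _ <= X]oB.
  by rewrite dvdn_leq_log ?cardG_gt0 // cardSg ?subsetT.
have sylC: p.-Sylow([set: base p]) (base_power (translations p)).
  rewrite pHallE subsetT /= p_part oB cardsXn prod_nat_const card_ord.
  by rewrite card_translations.
(* [R] is the conjugate of the power of [translations p] by some [x], so A_i contains the conjugate
   of [translations p] by [x i]. *)
have [x _ defR] := Sylow_trans sylC sylRT.
rewrite -{1}(card_translations p_pr) -(cardJg _ (x i)) cardSg //.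
apply/subsetP=> _ /imsetP[c Cc ->]; rewrite mem_coord_group -coord_embedJ.
have: coord_embed i c ^ x \in R.
  rewrite defR memJ_conjg; apply/base_powerP=> j; rewrite ffunE.
  by case: dfwithP.
by move/(subsetP (pHall_sub sylR)); rewrite inE.
Qed.

Lemma exists_conj_coord_core G :
    [transitive G, on [set: 'I_p * 'I_p] | 'P] ->
    G \subset wreath [set: 'S_p] [set: 'S_p] ->
  exists w (L : {group 'S_p}), forall i,
    coord_core (G :^ wreath_perm 1 w) i = L.
Proof.
move=> trG sGW; pose i0 := Ordinal (prime_gt0 p_pr).
have /fin_all_exists[f fP] i :
    exists v : base p, exists2 h, wreath_perm h v \in G & h i0 = i.
  have [t Gt /(congr1 fst)] :=
    atransP2 trG (in_setT (i0, i0)) (in_setT (i, i0)).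
  have /mem_wreathT[h [v def_t]] := subsetP sGW t Gt.
  by rewrite /= /aperm def_t permE /= => def_i; exists v, h; rewrite -?def_t.
(* An element of [G] with base part [f i] takes block [i0] to block [i], so L_i is L_{i0} conjugated
   by [f i i0]; the inverse undoes this, and every core becomes L_{i0}. *)
exists [ffun i => (f i i0)^-1], (coord_core G i0) => i.
have [h Ghv def_i] := fP i.
rewrite -[X in coord_core _ X](perm1 i) coord_coreJ.
rewrite -{1}def_i (coord_core_norm _ Ghv).
by apply/group_inj; rewrite /= ffunE -conjsgM mulgV conjsg1.
Qed.

(** As every L_i equals [L], each (h, v) in [G] has all v_i normalising [L]. Then [G] is determined
    by its projection, its kernel and the coset of the kernel over each [h]. *)
Lemma wreath_crossed_char G (L : {group 'S_p}) :
    G \subset wreath [set: 'S_p] [set: 'S_p] ->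
    [transitive L, on [set: 'I_p] | 'P] ->
    (forall i, coord_core G i = L) ->
  exists phi : 'S_p -> coset_of (base_set G),
    [/\ base_power L \subset base_set G,
        base_set G \subset base_power 'N(L),
        [acts top_set G, on base_set G | base_action p],
        crossed_hom (base_action p / base_set G) (top_set G)
          (base_power 'N(L) / base_set G) phi
      & G :=: wreath_crossed (top_set G) L phi].
Proof.
move=> sGW trL defL; set K := base_set_group G.
have sLK: base_power L \subset K := base_power_coord_core defL.
have Nv h v : wreath_perm h v \in G -> v \in base_power 'N(L).
  move=> Ghv; apply/base_powerP=> i; rewrite inE -{2}(defL (h i)).
  by rewrite (coord_core_norm i Ghv) defL.
have sKN: K \subset base_power 'N(L).
  by apply/subsetP=> k; rewrite inE; apply: Nv.
have nKN := base_power_norm p_pr trL sLK sKN.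
have nKv h v : wreath_perm h v \in G -> v \in 'N(K).
  by move/Nv; apply: (subsetP nKN).
have actHK: [acts top_set G, on K | base_action p].
  apply/subsetP=> h /top_setP[v Gv]; rewrite inE in_setT inE.
  apply/subsetP=> k Kk; rewrite inE.
  (* Conjugation by (h, v) also conjugates by [v]; applying the inverse of [v] beforehand leaves h .
     k alone. *)
  have: k ^ v^-1 \in K by rewrite memJ_norm ?groupV ?(nKv _ _ Gv).
  rewrite !inE => Gk.
  by have := groupJ Gk Gv; rewrite wreath_permJ conjgKV.
(* The coset of any [v] over [h]; the value 1 is a default outside the projection. *)
pose phi h :=
  if [pick v | wreath_perm h v \in G] is Some v then coset K v else 1.
have phiE h v : wreath_perm h v \in G -> phi h = coset K v.
  rewrite /phi => Ghv; case: pickP => [w Ghw | /(_ v)]; last by rewrite Ghv.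
  apply/rcoset_kercosetP; rewrite ?(nKv _ _ Ghw) ?(nKv _ _ Ghv) //.
  by rewrite mem_rcoset -(mem_wreath_permMl _ Ghv) mulgKV.
exists phi; split=> //.
  split=> [h /top_setP[v Ghv] | h1 h2 /top_setP[v1 Gv1] /top_setP[v2 Gv2]].
    by rewrite (phiE _ _ Ghv) mem_quotient ?(Nv _ _ Ghv).
  have Gv21 := groupM Gv2 Gv1; rewrite wreath_permM in Gv21.
  have Hh1: h1 \in top_set G by apply/top_setP; exists v1.
  have Hh2: h2^-1 \in top_set_group G.
    by rewrite groupV; apply/top_setP; exists v2.
  rewrite (phiE _ _ Gv21) (phiE _ _ Gv1) (phiE _ _ Gv2).
  rewrite (@quotient_base_actE _ (top_set_group G)) ?(nKv _ _ Gv1) //.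
  rewrite morphM ?(nKv _ _ Gv2) //.
  have := nKv _ _ Gv21; rewrite groupMl //; exact: nKv Gv2.
apply/setP=> t; apply/idP/idP=> [Gt | /imset2P[h v Hh]].
  have /mem_wreathT[h [v def_t]] := subsetP sGW t Gt.
  rewrite def_t in Gt *; rewrite mem_wreath_crossed
    (phiE _ _ Gt) (Nv _ _ Gt) eqxx.
  by rewrite !andbT; apply/top_setP; exists v.
have /top_setP[w Ghw]: h \in top_set G := Hh.
case/setIdP=> Nv' /eqP; rewrite (phiE _ _ Ghw) => /esym eq_vw ->.
rewrite -[v](mulgKV w) (mem_wreath_permMl _ Ghw) -mem_rcoset.
by apply/rcoset_kercosetP; rewrite ?(nKv _ _ Ghw) ?(subsetP nKN).
Qed.

End Coordinates.

(** * Permutation equivalence and coordinates adapted to a block system *)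

Lemma perm_equiv_morphism (T U : finType) (f : T -> U) :
  bijective f ->
  exists2 r : {morphism [set: {perm T}] >-> {perm U}},
    'injm r & forall s x, r s (f x) = f (s x).
Proof.
case=> g fK gK.
(* The morphism transports [s] to f s f^-1; being injective, it also preserves the order of a
   group. *)
have r_inj (s : {perm T}) : injective (f \o s \o g).
  by move=> u u' /= /(can_inj fK)/perm_inj/(can_inj gK).
have rE (s : {perm T}) x : perm (r_inj s) (f x) = f (s x).
  by rewrite permE /= fK.
have rM : {in [set: {perm T}] &,
    {morph (fun s => perm (r_inj s)) : s t / s * t}}.
  by move=> s t _ _; apply/permP=> u; rewrite -[u]gK permM !rE permM.
exists (Morphism rM) => //; apply/injmP=> s t _ _ /= eq_st.
by apply/permP=> x; apply: (can_inj fK); rewrite -!rE eq_st.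
Qed.

Lemma perm_equiv_atrans (T U : finType) (A : {group {perm T}})
    (B : {group {perm U}}) :
  perm_equiv A B -> [transitive A, on [set: T] | 'P] ->
  [transitive B, on [set: U] | 'P].
Proof.
case=> f [g fK gK] AB trA; have [x _ defT] := imsetP trA.
apply/imsetP; exists (f x) => //; apply/esym/setP=> u; rewrite inE.
have [s As def_gu] := atransP2 trA (in_setT x) (in_setT (g u)).
have [r _ rE] := perm_equiv_morphism (Bijective fK gK).
apply/imsetP; exists (r s); first by apply/AB; exists s.
by rewrite /= /aperm rE -[s x]/(aperm x s) -[aperm x s]def_gu gK.
Qed.

Lemma mem_wreath_fibers p (t : {perm 'I_p * 'I_p}) :
    (forall x y, x.1 = y.1 -> (t x).1 = (t y).1) ->
  t \in wreath [set: 'S_p] [set: 'S_p].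
Proof.
move=> tP; case: (pickP 'I_p) => [j0 _ | I0]; last first.
  have -> : t = 1 by apply/permP=> -[i j]; have := I0 i.
  exact: (group1 (wreath_group _ _)).
(* The hypothesis concerns [t] and not its inverse, so the induced map on indices is shown
   surjective; finiteness makes it injective. *)
have hK : cancel (fun i => (t^-1 (i, j0)).1) (fun i => (t (i, j0)).1).
  by move=> i /=; rewrite (tP _ (t^-1 (i, j0))) // permKV.
have h_inj := can_inj (canF_sym hK).
have v_inj i : injective (fun j => (t (i, j)).2).
  move=> j j' eq_tj; suff: (i, j) = (i, j') by case.
  apply: (@perm_inj _ t); rewrite [LHS]surjective_pairing eq_tj.
  by rewrite (tP _ (i, j')) // -surjective_pairing.
apply/mem_wreathT; exists (perm h_inj), [ffun i => perm (@v_inj i)].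
apply/permP=> -[i j]; rewrite permE /wreath_fun /= ffunE !permE.
by rewrite [LHS]surjective_pairing (tP _ (i, j0)).
Qed.

Lemma top_set_trans p (G : {group {perm 'I_p * 'I_p}}) :
    [transitive G, on [set: 'I_p * 'I_p] | 'P] ->
    G \subset wreath [set: 'S_p] [set: 'S_p] ->
  [transitive top_set G, on [set: 'I_p] | 'P].
Proof.
move=> trG sGW; have [[i0 j0] _ _] := imsetP trG.
apply/imsetP; exists i0 => //; apply/esym/setP=> i; rewrite inE.
have [t Gt /(congr1 fst)] := atransP2 trG (in_setT (i0, j0)) (in_setT (i, j0)).
have /mem_wreathT[h [v def_t]] := subsetP sGW t Gt.
rewrite /= /aperm def_t permE /= => def_i; apply/imsetP; exists h => //.
by apply/top_setP; exists v; rewrite -def_t.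
Qed.

(** The number of blocks divides p^2 and is neither 1 nor p^2, so there are p blocks of p points. A
    point is sent to the position of its block among the blocks and its own position within that
    block. *)
Lemma exists_block_coordinates p (T : finType) (G : {group {perm T}}) :
    prime p -> #|T| = (p ^ 2)%N -> [transitive G, on [set: T] | 'P] ->
    imprimitive G ->
  exists2 f : T -> 'I_p * 'I_p, bijective f &
    {in G, forall (s : {perm T}) x y,
      (f x).1 = (f y).1 -> (f (s x)).1 = (f (s y)).1}.
Proof.
move=> p_pr oT trG /existsP[Q impQ].
have [partQ actQ /andP[Q_gt1 Q_lt]] := and3P impQ.
have [/eqP covQ tiQ ntQ] := and3P partQ.
have oQB B : B \in Q -> (#|Q| * #|B|)%N = (p ^ 2)%N.
  by move=> QB; rewrite (card_imprimitivity_block trG impQ QB).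
have [B QB] : exists B, B \in Q by apply/set0Pn; rewrite -card_gt0 ltnW.
have oQ : #|Q| = p.
  have /(dvdn_pfactor _ _ p_pr)[[|[|[|m]]] // _ oQ] : #|Q| %| p ^ 2.
  - by rewrite -(oQB B QB) dvdn_mulr.
  - by rewrite oQ in Q_gt1.
  by rewrite oQ cardsT oT ltnn in Q_lt.
have oB C : C \in Q -> #|C| = p.
  move/oQB; rewrite oQ expnS expn1 => /eqP.
  by rewrite eqn_pmul2l ?prime_gt0 // => /eqP.
have xB x : x \in pblock Q x by rewrite mem_pblock covQ.
have QxB x : pblock Q x \in Q by rewrite pblock_mem ?covQ.
have lt1 x : index (pblock Q x) (enum Q) < p.
  by rewrite -oQ cardE index_mem mem_enum.
have lt2 x : index x (enum (pblock Q x)) < p.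
  by rewrite -(oB _ (QxB x)) cardE index_mem mem_enum.
pose f x := (Ordinal (lt1 x), Ordinal (lt2 x)).
have f1P x y : (f x).1 = (f y).1 <-> pblock Q x = pblock Q y.
  split=> [/(congr1 val) /= | eqB]; last by apply: val_inj; rewrite /= eqB.
  by move/(index_inj set0) => -> //; rewrite mem_enum.
exists f.
  apply: inj_card_bij; last by rewrite card_prod card_ord oT expnS expn1.
  move=> x y eq_f; have eqB : pblock Q x = pblock Q y.
    by apply/f1P; rewrite eq_f.
  have /(congr1 (fun z => val z.2)) /= := eq_f; rewrite -eqB.
  by move/(index_inj x); apply; rewrite mem_enum // eqB.
move=> s Gs x y /f1P eqB; apply/f1P.
have QsB : ('P^*)%act (pblock Q x) s \in Q by rewrite (actsP actQ).
(* The image of a block under [s] is again a block, so the block of [s z] depends only on that of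
   [z]. *)
have defB z : pblock Q z = pblock Q x ->
    pblock Q (s z) = ('P^*)%act (pblock Q x) s.
  move=> eq_zx; apply: def_pblock => //; rewrite -eq_zx.
  exact: (imset_f (aperm^~ s) (xB z)).
by rewrite !defB.
Qed.
Theorem proposition1 (p : nat) (p_pr : prime p) :
  (forall (H L : {group 'S_p}) (K : {group base p}) (phi : 'S_p -> coset_of K),
     [transitive H, on [set: 'I_p] | 'P] ->
     [transitive L, on [set: 'I_p] | 'P] ->
     simple L ->
     base_power L \subset K ->
     K \subset base_power 'N(L) ->
     [acts H, on K | base_action p] ->
     crossed_hom (base_action p / K) H (base_power 'N(L) / K) phi ->
     let G := wreath_crossed H L phi in
     [/\ group_set G,
         [transitive G, on [set: 'I_p * 'I_p] | 'P],
         imprimitive G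
       & forall P : {group {perm 'I_p * 'I_p}},
           p.-Sylow(G) P -> P \isog Zp_wr_Zp p])
  /\
  (forall (T : finType) (G : {group {perm T}}),
     #|T| = (p ^ 2)%N ->
     [transitive G, on [set: T] | 'P] ->
     imprimitive G ->
     (exists2 P : {group {perm T}}, p.-Sylow(G) P & P \isog Zp_wr_Zp p) ->
     exists (H L : {group 'S_p}) (K : {group base p})
            (phi : 'S_p -> coset_of K),
       [/\ [transitive H, on [set: 'I_p] | 'P],
           [transitive L, on [set: 'I_p] | 'P]
         & simple L]
       /\
       [/\ base_power L \subset K,
           K \subset base_power 'N(L),
           [acts H, on K | base_action p],
           crossed_hom (base_action p / K) H (base_power 'N(L) / K) phi
         & perm_equiv G (wreath_crossed H L phi)]).
Proof.
split=> [H L K phi trH trL _ sLK sKN actHK phiP G |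
         T G oT trG impG [P sylP isoP]].
  have gG : group_set G by apply: group_set_wreath_crossed.
  split=> // [||P sylP].
  - exact: wreath_crossed_trans.
  - exact: wreath_crossed_imprimitive.
  apply: (@Sylow_isog_Zp_wr_Zp p P (Group gG)) => //.
  exact: dvdn_card_wreath_crossed.
have [f f_bij fG] := exists_block_coordinates p_pr oT trG impG.
have [r injr rE] := perm_equiv_morphism f_bij.
have [g fK gK] := f_bij.
have sG1W : (r @* G)%G \subset wreath [set: 'S_p] [set: 'S_p].
  apply/subsetP=> _ /morphimP[s _ Gs ->]; apply: mem_wreath_fibers => x y.
  by rewrite -[x]gK -[y]gK !rE; apply: fG.
(* Every conjugate of the transported group is still equivalent to [G], which leaves the choice of
   coordinates inside the blocks free. *)
have equivJ t : perm_equiv G ((r @* G) :^ t).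
  exists (t \o f) => [|u]; first exact: bij_comp (injF_bij perm_inj) f_bij.
  split=> [/imsetP[_ /morphimP[s _ Gs ->] ->] | [s Gs uE]].
    by exists s => // x; rewrite /= permJ rE.
  suff -> : u = r s ^ t by rewrite memJ_conjg mem_morphim ?inE.
  by apply/permP=> x; rewrite -[x](permKV t) -[t^-1 x]gK permJ rE; apply: uE.
have trG1 : [transitive r @* G, on [set: 'I_p * 'I_p] | 'P].
  by apply: perm_equiv_atrans trG; have := equivJ 1; rewrite conjsg1.
have [w [L defL]] := exists_conj_coord_core p_pr trG1 sG1W.
pose G2 := ((r @* G) :^ wreath_perm 1 w)%G.
have sG2W : G2 \subset wreath [set: 'S_p] [set: 'S_p].
  have Ww : wreath_perm 1 w \in wreath_group [set: 'S_p]%G [set: 'S_p]%G.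
    by apply/mem_wreathT; exists 1, w.
  by rewrite -(conjGid Ww) conjSg.
have trG2 : [transitive G2, on [set: 'I_p * 'I_p] | 'P].
  by apply: perm_equiv_atrans trG; apply: equivJ.
(* The Sylow hypothesis enters here, as divisibility of the order by p^(p+1). *)
have pG2 : (p ^ p.+1)%N %| #|G2|.
  rewrite cardJg card_injm ?subsetT // -(card_Zp_wr_Zp p_pr) -(card_isog isoP).
  by rewrite cardSg ?(pHall_sub sylP).
have pA i := dvdn_card_coord_group p_pr i sG2W pG2.
have i0 := Ordinal (prime_gt0 p_pr).
have trL : [transitive L, on [set: 'I_p] | 'P].
  by rewrite -(defL i0); apply/trans_dvdn_card/dvdn_card_gen_p_elts.
have simL : simple L by rewrite -(defL i0); apply: simple_gen_p_elts.
have [phi [sLK sKN actHK phiP defG2]] := wreath_crossed_char p_pr sG2W trL defL.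
exists (top_set_group G2), L, (base_set_group G2), phi.
split; split=> //; first exact: top_set_trans.
by rewrite /= -defG2; apply: equivJ.
Qed.
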